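(* A matroid is simple graphic if and only if it is isomorphic to a simple segment binary matroid.
   Context: A matroid is simple graphic if it is (isomorphic to) the cycle matroid of a simple undirected graph (elements: edges; circuits: cycles). For a matrix $A$ over $\mathbb{Z}_2$, $M[A]$ denotes its column (vector) matroid over $\mathbb{Z}_2$ (a binary matroid). $M[A]$ is a segment binary matroid if every column of $A$ has the consecutive $1$'s property (its $1$'s occupy consecutive coordinates); it is a simple segment binary matroid if moreover the columns of $A$ are non-zero and pairwise distinct. *)

(* Defs.v *)
From mathcomp Require Import all_boot all_order all_algebra.

Set Implicit Arguments.
Unset Strict Implicit.
Unset Printing Implicit Defensive.

Import GRing.Theory.
Local Open Scope ring_scope.

Record matroid := Matroid {
  ground :> finType;
  indep : {set ground} -> Prop;
  indep0 : indep set0;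
  indepS : forall A B : {set ground}, A \subset B -> indep B -> indep A;
  indep_aug : forall A B : {set ground}, indep A -> indep B -> (#|A| < #|B|)%N ->
    exists2 x, x \in B :\: A & indep (x |: A)
}.

Definition circuit (M : matroid) (C : {set M}) : Prop :=
  ~ indep C /\ forall D : {set M}, D \proper C -> indep D.

Definition matroid_iso (M N : matroid) : Prop :=
  exists2 f : M -> N, bijective f &
    forall A : {set M}, indep A <-> indep [set f x | x in A].

Section LinearIndependence.
Variables (F : fieldType) (vT : vectType F) (E : finType) (v : E -> vT).
Implicit Types A B : {set E}.

(* [free] is applied to the family, not to its set of values: two equal vectors
   with distinct indices are dependent. *)
Definition lin_indep A : Prop := free [seq v x | x in A].

Lemma lin_indep0 : lin_indep set0.
Proof. by rewrite /lin_indep /image_mem enum_set0 nil_free. Qed.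

Lemma perm_lin A s : uniq s -> s =i A ->
  perm_eq [seq v x | x in A] [seq v x | x <- s].
Proof.
move=> us sA; apply: perm_map; apply: uniq_perm => // [|x].
  exact: enum_uniq.
by rewrite mem_enum sA.
Qed.

Lemma lin_indepU1 x A : x \notin A ->
  free [seq v y | y in x |: A]
    = (v x \notin <<[seq v y | y in A]>>%VS) && free [seq v y | y in A].
Proof.
move=> xA; rewrite -free_cons; apply: perm_free.
have -> : v x :: [seq v y | y in A] = [seq v y | y <- x :: enum A] by [].
apply: perm_lin => [|y]; first by rewrite /= mem_enum xA enum_uniq.
by rewrite !inE mem_enum.
Qed.

Lemma lin_indepS A B : A \subset B -> lin_indep B -> lin_indep A.
Proof.
move=> sAB; rewrite /lin_indep.
have -> : free [seq v x | x in B]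
    = free ([seq v x | x <- enum A] ++ [seq v x | x <- enum (B :\: A)]).
  apply: perm_free; rewrite -map_cat; apply: perm_lin => [|x].
    rewrite cat_uniq !enum_uniq andbT /=; apply/hasPn => x.
    by rewrite !mem_enum inE => /andP[].
  rewrite mem_cat !mem_enum inE; case: (boolP (x \in A)) => //= xA.
  by rewrite (subsetP sAB).
exact: catl_free.
Qed.

Lemma lin_indep_aug A B : lin_indep A -> lin_indep B -> (#|A| < #|B|)%N ->
  exists2 x, x \in B :\: A & lin_indep (x |: A).
Proof.
move=> fA fB ltAB; case: (boolP [exists x in B, v x \notin <<[seq v y | y in A]>>%VS]).
  case/exists_inP=> x xB nx.
  have xA : x \notin A.
    by apply: contra nx => xA; apply: memv_span; apply: image_f.
  exists x; first by rewrite inE xA.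
  by rewrite /lin_indep lin_indepU1 // nx.
rewrite negb_exists_in => /forall_inP H; exfalso.
have sub : (<<[seq v x | x in B]>> <= <<[seq v x | x in A]>>)%VS.
  apply/span_subvP => w /mapP[x]; rewrite mem_enum => xB ->.
  by have := H _ xB; rewrite negbK.
have := dimvS sub; rewrite /lin_indep in fA fB.
by move/eqP: fB => ->; move/eqP: fA => ->; rewrite !size_map -!cardE leqNgt ltAB.
Qed.

Lemma lin_dep_sum A (D : {set E}) (c : E -> F) x : D \subset A -> x \in D ->
  c x != 0 -> \sum_(y in D) c y *: v y = 0 -> ~ lin_indep A.
Proof.
move=> sDA xD cx0 s0 /(lin_indepS sDA).
have {1}-> : D = x |: (D :\ x) by rewrite setD1K.
rewrite /lin_indep lin_indepU1 ?inE ?eqxx // => /andP[/negP nx _]; apply: nx.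
move: s0; rewrite (bigD1 x) //= => /eqP; rewrite addr_eq0 => /eqP s0.
rewrite -[v x]scale1r -(mulVf cx0) -scalerA s0; apply: memvZ; rewrite memvN.
apply: memv_suml => y /andP[yD yx]; apply: memvZ; apply: memv_span.
by apply: image_f; rewrite !inE yx.
Qed.

Lemma lin_indep_coef A :
  (forall c : E -> F, \sum_(x in A) c x *: v x = 0 -> forall x, x \in A -> c x = 0) ->
  lin_indep A.
Proof.
move=> H; rewrite /lin_indep.
have sz : size [seq v x | x in A] == #|A| by rewrite size_map -cardE.
rewrite -[X in free X]/(tval (Tuple sz)); apply/freeP => k k0 i.
have iA := enum_valP i.
have := H (fun x => k (enum_rank_in iA x)).
rewrite big_enum_val /= => /(_ _ _ iA); rewrite enum_valK_in; apply.
rewrite -[RHS]k0; apply: eq_bigr => j _.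
by rewrite enum_valK_in /= nth_image.
Qed.

End LinearIndependence.

Definition vector_matroid (F : fieldType) (m n : nat) (A : 'M[F]_(m, n)) : matroid :=
  let v := fun j : 'I_n => col j A in
  Matroid (lin_indep0 v) (@lin_indepS _ _ _ v) (@lin_indep_aug _ _ _ v).

Record sgraph := SGraph {
  vertex :> finType;
  edges : {set {set vertex}};
  edges_card : forall u, u \in edges -> #|u| = 2
}.

Definition edge (G : sgraph) : Type := {u : {set G} | u \in edges G}.

Definition adj (G : sgraph) : rel G := fun x y => [set x; y] \in edges G.

(* [c] is read cyclically: the last vertex is adjacent to the first one. *)
Definition is_cycle (G : sgraph) (c : seq G) : bool :=
  [&& (2 < size c)%N, uniq c & cycle (@adj G) c].

Definition cycle_edges (G : sgraph) (c : seq G) : {set edge G} :=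
  [set u : edge G | [exists x in c, val u == [set x; next c x]]].

Definition acyclic (G : sgraph) (S : {set edge G}) : Prop :=
  forall c : seq G, is_cycle c -> ~ cycle_edges c \subset S.

Lemma min_degree_cycle (V : finType) (r : rel V) x0 y0 :
  symmetric r -> irreflexive r ->
  (forall x y, r x y -> exists2 z, z != y & r x z) -> r x0 y0 ->
  exists2 c : seq V, (2 < size c)%N & uniq c && cycle r c.
Proof.
move=> rS rI deg r0.
have H : forall n, (exists2 c : seq V, (2 < size c)%N & uniq c && cycle r c) \/
    exists x y p, [/\ size p = n, path r x (y :: p) & uniq (x :: y :: p)].
  elim=> [|n [|[x [y [p [sp px up]]]]]]; [right | by left |].
    exists x0, y0, [::]; split; rewrite //= ?r0 // inE andbT.
    by apply: contraTneq r0 => ->; rewrite rI.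
  have /andP[rxy _] := px; have [z nzy rxz] := deg _ _ rxy.
  have nzx : z != x by apply: contraTneq rxz => ->; rewrite rI.
  case: (boolP (z \in y :: p)) => zp; last first.
    right; exists z, x, (y :: p); split; first by rewrite /= sp.
      by rewrite [path _ _ _]/= rS rxz.
    by rewrite cons_uniq up inE negb_or nzx zp.
  left; move: zp; rewrite inE (negPf nzy) /= => zp.
  case/path.splitP: zp px up => p1 p2.
  rewrite -cat_cons cat_path -cat_cons cat_uniq => /andP[px _] /andP[up _].
  exists (x :: y :: rcons p1 z); first by rewrite /= size_rcons.
  rewrite -/(cat [:: x] _) in up *; rewrite up /=.
  by move: px => /= /andP[-> px]; rewrite rcons_path px last_rcons rS rxz.
have {H}[//|[x [y [p [sp _ up]]]]] := H #|V|.
have := max_card (mem (x :: y :: p)); rewrite (card_uniqP up) /= sp.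
by rewrite leqNgt leqnSn.
Qed.

Section CycleMatroid.
Variable G : sgraph.
Implicit Types (c : seq G) (S T : {set edge G}).

Lemma adj_sym : symmetric (@adj G).
Proof. by move=> x y; rewrite /adj setUC. Qed.

Lemma adj_irr : irreflexive (@adj G).
Proof.
move=> x; apply/negP => /edges_card; by rewrite setUid cards1.
Qed.

Definition incidence (u : edge G) : {ffun G -> ('F_2)^o} :=
  [ffun x => (x \in val u)%:R].

Lemma set2_next_inj c : is_cycle c ->
  {in c &, injective (fun x => [set x; next c x])}.
Proof.
case/and3P=> sc uc _ x y xc yc /= exy; apply: contraTeq isT => nxy.
have ynx : y = next c x.
  have : y \in [set x; next c x] by rewrite exy !inE eqxx.
  by rewrite !inE eq_sym (negPf nxy) => /eqP.
have xny : x = next c y.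
  have : x \in [set y; next c y] by rewrite -exy !inE eqxx.
  by rewrite !inE (negPf nxy) => /eqP.
case/rot_to: xc => i p ep; move: (xny); rewrite ynx.
rewrite -!(next_rot i uc) ep.
have : uniq (x :: p) by rewrite -ep rot_uniq.
have : (2 < size (x :: p))%N by rewrite -ep size_rot.
case: p {ep} => [|a [|b p]] //= _; rewrite eqxx !inE !negb_or.
case/and3P=> /and3P[nxa nxb _] _ _; rewrite eq_sym (negPf nxa) eqxx => /eqP.
by rewrite (negPf nxb).
Qed.

Lemma cycle_edges_perm c : is_cycle c ->
  perm_eq [seq val u | u in cycle_edges c] [seq [set x; next c x] | x <- c].
Proof.
move=> cc; have /and3P[sc uc ac] := cc; apply: uniq_perm => [||w].
- by rewrite map_inj_uniq ?enum_uniq //; apply: val_inj.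
- by rewrite map_inj_in_uniq //; apply: set2_next_inj.
apply/mapP/mapP => [[u]|[x xc ->]].
  by rewrite mem_enum inE => /exists_inP[x xc /eqP ->] ->; exists x.
have e := next_cycle ac xc.
exists (exist _ [set x; next c x] e : edge G); last by rewrite SubK.
by rewrite mem_enum inE; apply/exists_inP; exists x; rewrite // SubK.
Qed.

Lemma acyclic_lin S : acyclic S <-> lin_indep incidence S.
Proof.
split=> [aS|fS c cc sub].
  apply: lin_indep_coef => k k0 u uS; apply/eqP; apply: contraT => ku.
  pose r : rel G := fun x y => [exists w in S, (k w != 0) && (val w == [set x; y])].
  have rP x y : reflect (exists w, [/\ w \in S, k w != 0 & val w = [set x; y]]) (r x y).
    apply: (iffP exists_inP) => [[w wS /andP[kw /eqP ew]]|[w [wS kw ew]]].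
      by exists w.
    by exists w; rewrite // kw ew eqxx.
  have radj : subrel r (@adj G).
    by move=> x y /rP[w [_ _ ew]]; rewrite /adj -ew (valP w).
  have rS : symmetric r by move=> x y; rewrite /r setUC.
  have rI : irreflexive r.
    by move=> x; apply: contraFF (adj_irr x); apply: radj.
  have deg x y : r x y -> exists2 z, z != y & r x z.
    case/rP=> w [wS kw ew].
    have /existsP[w' /and4P[w'S nw kw' xw']] :
        [exists w', [&& w' \in S, w' != w, k w' != 0 & x \in val w']].
      apply: contraNT kw; rewrite negb_exists => /forallP H.
      move/ffunP/(_ x): k0; rewrite sum_ffunE ffunE (bigD1 w) //= big1 => [|w'].
        by rewrite addr0 !ffunE ew !inE eqxx /= /GRing.scale /= mulr1 => ->.
      case/andP=> w'S nw; have := H w'; rewrite w'S nw /= negb_and negbK !ffunE.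
      case/orP=> [/eqP->|/negPf->]; first by rewrite scale0r.
      by rewrite scaler0.
    have /eqP := edges_card (valP w').
    case/cards2P=> a [b [nab ew']].
    wlog eax : a b nab ew' / a = x.
      move=> th; move: (xw'); rewrite ew' !inE => /orP[] /eqP/esym e.
        by apply: (th a b).
      by apply: (th b a); rewrite // 1?eq_sym // setUC.
    subst a; exists b; last by apply/rP; exists w'.
    by apply: contra nw => /eqP eb; apply/eqP/val_inj; rewrite ew ew' eb.
  have [x [y [nxy eu]]] : exists x y, x != y /\ val u = [set x; y].
    by have /eqP/cards2P[x [y [nxy eu]]] := edges_card (valP u); exists x, y.
  have r0 : r x y by apply/rP; exists u.
  have [c sc /andP[uc rc]] := min_degree_cycle rS rI deg r0.
  have cc : is_cycle c by rewrite /is_cycle sc uc /= (sub_cycle radj).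
  case: (aS c cc); apply/subsetP => w; rewrite inE => /exists_inP[z zc /eqP ew].
  have /rP[w' [w'S _ ew']] := next_cycle rc zc.
  by have -> : w = w' by apply: val_inj; rewrite ew ew'.
have /and3P[sc uc ac] := cc.
have [x xc] : exists x, x \in c by case: c sc {cc sub uc ac} => // x c _; exists x; rewrite inE eqxx.
pose u : edge G := exist _ [set x; next c x] (next_cycle ac xc).
have uC : u \in cycle_edges c.
  by rewrite inE; apply/exists_inP; exists x; rewrite // SubK.
apply: (@lin_dep_sum _ _ _ incidence S (cycle_edges c) (fun=> 1) u) => //.
apply/ffunP => z; rewrite sum_ffunE [RHS]ffunE.
transitivity (\sum_(w <- [seq val u | u in cycle_edges c]) (z \in w)%:R : 'F_2).
  rewrite big_map -big_enum /=; apply: eq_bigr => w _.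
  by rewrite !ffunE /GRing.scale /= mul1r.
rewrite (perm_big _ (cycle_edges_perm cc)) big_map big_seq.
transitivity (\sum_(y <- c | y \in c) ((z == y)%:R + (z == next c y)%:R : 'F_2)).
  apply: eq_bigr => y yc; rewrite !inE.
  have : y != next c y.
    by apply: contraTneq (next_cycle ac yc) => <-; rewrite adj_irr.
  case: (z =P y) => [->|_] ny; last by rewrite add0r.
  by rewrite (negPf ny) addr0.
rewrite -big_seq big_split /=.
have -> : \sum_(y <- c) (z == next c y)%:R = \sum_(y <- c) (z == y)%:R :> 'F_2.
  rewrite -(big_map (next c) xpredT (fun y => (z == y)%:R)); apply: perm_big.
  have un : uniq (map (next c) c).
    by rewrite map_inj_uniq //; apply: can_inj (prev_next uc).
  apply: uniq_perm => // y; apply/mapP/idP => [[w wc ->]|yc].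
    by rewrite mem_next.
  by exists (prev c y); rewrite ?mem_prev ?next_prev.
by rewrite -mulr2n -mulr_natr pchar_Fp_0 // mulr0.
Qed.

Lemma acyclic0 : acyclic (set0 : {set edge G}).
Proof. exact/acyclic_lin/lin_indep0. Qed.

Lemma acyclicS S T : S \subset T -> acyclic T -> acyclic S.
Proof. by move=> sST aT c cc /subset_trans/(_ sST); apply: aT. Qed.

Lemma acyclic_aug S T : acyclic S -> acyclic T -> (#|S| < #|T|)%N ->
  exists2 u, u \in T :\: S & acyclic (u |: S).
Proof.
move=> /acyclic_lin lS /acyclic_lin lT ltST.
have [u uTS lu] := lin_indep_aug lS lT ltST.
by exists u => //; apply/acyclic_lin.
Qed.

Definition cycle_matroid : matroid := Matroid acyclic0 acyclicS acyclic_aug.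

End CycleMatroid.

Lemma cycle_edgesP (G : sgraph) (c : seq G) (u : edge G) :
  reflect (exists2 x, x \in c & val u = [set x; next c x]) (u \in cycle_edges c).
Proof.
by rewrite inE; apply: (iffP exists_inP) => [[x xc /eqP]|[x xc ->]]; exists x.
Qed.

Lemma cycle_neighbour (G : sgraph) (c : seq G) (u : edge G) x z : is_cycle c ->
  u \in cycle_edges c -> val u = [set x; z] ->
  x \in c /\ (z = next c x \/ z = prev c x).
Proof.
move=> cc /cycle_edgesP[y yc ->] e; have /and3P[sc uc ac] := cc.
have nyn : y != next c y.
  by apply: contraTneq (next_cycle ac yc) => <-; rewrite adj_irr.
have : x \in [set y; next c y] by rewrite e set21.
have nxz : x != z.
  apply: contraTneq nyn => xz; have := cards2 y (next c y).
  by rewrite e xz setUid cards1; case: eqP.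
have : z \in [set y; next c y] by rewrite e set22.
rewrite !inE => /orP[]/eqP ez /orP[]/eqP ex; move: nxz; rewrite ex ez ?eqxx // => _.
  by rewrite mem_next prev_next //; split => //; right.
by split => //; left.
Qed.

Lemma circuit_cycleP (G : sgraph) (C : {set cycle_matroid G}) :
  circuit C <-> exists2 c : seq G, is_cycle c & C = cycle_edges c.
Proof.
have dep c : is_cycle c -> ~ acyclic (cycle_edges c) by move=> cc /(_ c cc) [].
split=> [[dC mC]|[c cc ->]].
  have [c /andP[cc sub]] : exists c : seq G, is_cycle c && (cycle_edges c \subset C).
    case: (boolP [exists n : 'I_#|G|.+1, [exists c : n.-tuple G,
        is_cycle c && (cycle_edges c \subset C)]]) => [|nC].
      by case/existsP=> n /existsP[c Hc]; exists c.
    case: dC => c cc sub; have /and3P[_ uc _] := cc; case/negP: nC.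
    have sc : (size c < #|G|.+1)%N by rewrite ltnS -(card_uniqP uc) max_card.
    by apply/existsP; exists (Ordinal sc); apply/existsP; exists (in_tuple c); rewrite cc.
  exists c => //; apply/eqP; rewrite eq_sym eqEproper sub; apply/negP => /mC.
  exact: dep.
split=> [|D pD c' cc' sub]; first exact: dep.
have := sub_proper_trans sub pD; rewrite properE => /andP[/subsetP sC /negP]; apply.
have /and3P[sc uc ac] := cc; have /and3P[sc' uc' ac'] := cc'.
have step x : x \in c' -> x \in c /\ exists2 u, u \in cycle_edges c' & val u = [set x; next c x].
  move=> xc'; pose y := prev c' x; have yc' : y \in c' by rewrite mem_prev.
  have yx : next c' y = x by rewrite next_prev.
  pose u : edge G := exist _ [set x; next c' x] (next_cycle ac' xc').
  pose w : edge G := exist _ [set y; next c' y] (next_cycle ac' yc').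
  have uC : u \in cycle_edges c' by apply/cycle_edgesP; exists x.
  have wC : w \in cycle_edges c' by apply/cycle_edgesP; exists y.
  have ew : val w = [set x; y] by rewrite /= yx setUC.
  have [xc nx] := cycle_neighbour cc (sC _ uC) erefl.
  have [_ ny] := cycle_neighbour cc (sC _ wC) ew.
  split=> //; case: nx => nx; first by exists u; rewrite // -nx.
  case: ny => ny; first by exists w; rewrite // -ny.
  have : x = y.
    apply: (set2_next_inj cc' xc' yc'); rewrite yx /= nx -ny.
    by rewrite setUC.
  by move=> exy; have := valP w; rewrite /= yx -exy; move/edges_card; rewrite setUid cards1.
have [x0 x0c'] : exists x, x \in c'.
  by case: (c') sc' => // x s _; exists x; rewrite inE eqxx.
have cl x : x \in c' -> next c x \in c'.
  move=> xc'; have [_ [u /cycle_edgesP[y yc' ->] e]] := step x xc'.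
  have : next c x \in [set y; next c' y] by rewrite e set22.
  by rewrite !inE => /orP[] /eqP->; rewrite ?mem_next.
apply/subsetP => u /cycle_edgesP[y yc eu].
have yc' : y \in c'.
  have [x0c _] := step x0 x0c'.
  have : fconnect (next c) x0 y by rewrite (fconnect_cycle (cycle_next uc)).
  by move=> /iter_findex <-; elim: (findex _ _ _) => //= n; apply: cl.
have [_ [w wC' ew]] := step y yc'.
by have -> : u = w by apply: val_inj; rewrite eu ew.
Qed.

Definition simple_graphic (M : matroid) : Prop :=
  exists G : sgraph, matroid_iso M (cycle_matroid G).

Definition consecutive_ones (m : nat) (v : 'cV['F_2]_m) : Prop :=
  exists a b : nat, forall i : 'I_m, v i 0 = 1 <-> (a <= i < b)%N.

Definition segment (m n : nat) (A : 'M['F_2]_(m, n)) : Prop :=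
  forall j, consecutive_ones (col j A).

Definition simple_segment (m n : nat) (A : 'M['F_2]_(m, n)) : Prop :=
  [/\ segment A, forall j, col j A != 0 & injective (fun j => col j A)].

(* Main.v *)
Require Import Defs.
From mathcomp Require Import all_boot all_order all_algebra.
From mathcomp Require Import zify.

(** Order the vertices of a graph linearly and replace the incidence vector of
an edge over Z_2 by its vector of prefix sums: the edge {p < q} becomes the
indicator of the segment [p, q).  Taking prefix sums is an injective linear
map, so the dependencies are the same.  Conversely every nonempty segment
[p, q) of m coordinates comes from the edge {p, q} on the m + 1 vertices
0, ..., m. *)

Set Implicit Arguments.
Unset Strict Implicit.
Unset Printing Implicit Defensive.

Import GRing.Theory.
Local Open Scope ring_scope.

Lemma matroid_iso_sym (M N : matroid) : matroid_iso M N -> matroid_iso N M.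
Proof.
case=> f [g fK gK] iso; exists g; first by exists f.
by move=> A; rewrite iso -imset_comp (eq_imset _ gK) imset_id.
Qed.

Lemma matroid_iso_trans (M N P : matroid) :
  matroid_iso M N -> matroid_iso N P -> matroid_iso M P.
Proof.
case=> f bf isof [g bg isog]; exists (g \o f); first exact: bij_comp.
by move=> A; rewrite isof isog -imset_comp.
Qed.

Lemma lin_indepP (F : fieldType) (vT : vectType F) (E : finType) (v : E -> vT)
    (A : {set E}) :
  lin_indep v A <-> forall c : E -> F,
    \sum_(x in A) c x *: v x = 0 -> forall x, x \in A -> c x = 0.
Proof.
split=> [indA c c0 x xA|]; last exact: lin_indep_coef.
apply/eqP; apply: contraT => cx0.
by case: (lin_dep_sum (subxx A) xA cx0 c0).
Qed.

(** Independence is compared through relations with the same coefficients on both sides, so no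
    linear map between [vT] and [wT] has to be built. *)
Lemma lin_indep_imset (F : fieldType) (vT wT : vectType F) (E E' : finType)
    (v : E -> vT) (w : E' -> wT) (g : E -> E') (A : {set E}) :
  bijective g ->
  (forall c : E -> F,
     \sum_(x in A) c x *: v x = 0 <-> \sum_(x in A) c x *: w (g x) = 0) ->
  lin_indep v A <-> lin_indep w [set g x | x in A].
Proof.
move=> [h gK hK] vw; rewrite !lin_indepP; split=> indA c.
  rewrite big_imset /=; last by move=> x y _ _; apply: can_inj gK x y.
  move=> /(vw (c \o g))/indA c0 _ /imsetP[x xA ->]; exact: c0.
move=> /vw c0 x xA; rewrite -[x]gK; apply: (indA (c \o h)); last exact: imset_f.
rewrite big_imset /=; last by move=> y z _ _; apply: can_inj gK y z.
by rewrite -[RHS]c0; apply: eq_bigr => y _; rewrite gK.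
Qed.

(** The sum counts the ends of [u] of rank below [k]: none, then only [p], then both, which
    cancel. *)
Lemma prefix_sum_incidence (G : sgraph) (r : G -> nat) (u : edge G) (p q : G) k :
  val u = [set p; q] -> (r p < r q)%N ->
  \sum_(x | (r x < k)%N) incidence u x = (r p < k <= r q)%:R.
Proof.
move=> eu rpq; have npq : p != q by apply: contraTneq rpq => ->; rewrite ltnn.
have -> : \sum_(x | (r x < k)%N) incidence u x
    = \sum_(x in [set p; q]) (r x < k)%:R :> 'F_2.
  rewrite big_mkcond [RHS]big_mkcond; apply: eq_bigr => x _.
  by rewrite ffunE eu; case: (_ < _)%N; case: (_ \in _).
rewrite big_setU1 ?inE //= big_set1.
case: (ltnP (r q) k) => rqk; last by rewrite addr0 andbT.
(* Both ends are counted, and [1 + 1 = 0] in ['F_2]. *)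
rewrite (ltn_trans rpq rqk) /=; exact: val_inj.
Qed.

(** As [r] is injective, the prefixes with bounds [r x] and [(r x).+1] differ by [x] alone. *)
Lemma prefix_sum_inj (V : finType) (r : V -> nat) (Z : zmodType) (s : V -> Z) :
  injective r -> (forall k, \sum_(x | (r x < k)%N) s x = 0) -> forall x, s x = 0.
Proof.
move=> inj_r s0 x; have := s0 (r x).+1; rewrite (bigD1 x) //=.
rewrite (eq_bigl (fun y => (r y < r x)%N)) ?s0 ?addr0 // => y.
by rewrite ltnS ltn_neqAle (inj_eq inj_r) andbC.
Qed.

(** Both directions of the theorem reduce to producing such an [r] and [g]. Segments are half-open,
    so [m] coordinates leave room for the ranks 0 to [m]. *)
Definition segment_encoding (G : sgraph) (m n : nat) (A : 'M['F_2]_(m, n))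
    (r : G -> nat) (g : 'I_n -> edge G) : Prop :=
  forall j, exists p q : G, [/\ val (g j) = [set p; q], (r p < r q)%N
    & forall i, A i j = (r p <= i < r q)%:R].

Lemma segment_encoding_iso (G : sgraph) (m n : nat) (A : 'M['F_2]_(m, n))
    (r : G -> nat) (g : 'I_n -> edge G) :
  injective r -> (forall x, r x <= m)%N -> bijective g ->
  segment_encoding A r g -> matroid_iso (vector_matroid A) (cycle_matroid G).
Proof.
move=> inj_r r_le bij_g enc; exists g => // B.
apply: iff_trans (iff_sym (acyclic_lin _)); apply: lin_indep_imset => // c.
set s := \sum_(j in B) c j *: incidence (g j).
have prefix (i : 'I_m) :
    \sum_(x | (r x < i.+1)%N) s x = (\sum_(j in B) c j *: col j A) i 0.
  under eq_bigr do rewrite sum_ffunE.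
  rewrite exchange_big summxE; apply: eq_bigr => j _.
  have [p [q [eg rpq eA]]] := enc j.
  rewrite !mxE eA -(prefix_sum_incidence i.+1 eg rpq) mulr_sumr.
  by apply: eq_bigr => x _; rewrite ffunE.
split=> [t0|s0]; last first.
  apply/matrixP => i j; rewrite ord1 -prefix s0 mxE big1 // => x _.
  by rewrite ffunE.
apply/ffunP => x; rewrite [RHS]ffunE; move: x; apply: (prefix_sum_inj inj_r) => k.
case: k => [|i]; first by rewrite big_pred0.
case: (ltnP i m) => im; first by rewrite (prefix (Ordinal im)) t0 mxE.
(* Here the bound exceeds [m] and matches no row of [A]; all ranks lie below it, so the two ends of
   each edge cancel. *)
under eq_bigr do rewrite sum_ffunE.
rewrite exchange_big big1 // => j _; have [p [q [eg rpq _]]] := enc j.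
under eq_bigr do rewrite ffunE.
rewrite -scaler_sumr (prefix_sum_incidence _ eg rpq).
by rewrite [(i < r q)%N]ltnNge (leq_trans (r_le q) im) andbF scaler0.
Qed.

Lemma segment_encoding_simple (G : sgraph) (m n : nat) (A : 'M['F_2]_(m, n))
    (r : G -> nat) (g : 'I_n -> edge G) :
  injective r -> (forall x, r x <= m)%N -> injective g ->
  segment_encoding A r g -> simple_segment A.
Proof.
move=> inj_r r_le inj_g enc; split=> [j|j|j j' /= ejj'].
- have [p [q [_ _ eA]]] := enc j; exists (r p), (r q) => i.
  by rewrite mxE eA; case: (_ <= _ < _)%N.
- have [p [q [_ rpq eA]]] := enc j.
  have pm : (r p < m)%N by apply: leq_trans rpq (r_le q).
  apply/eqP => /matrixP/(_ (Ordinal pm) 0).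
  by rewrite !mxE eA /= leqnn rpq.
have [p [q [eg rpq eA]]] := enc j; have [p' [q' [eg' rpq' eA']]] := enc j'.
have seg i : (i < m)%N -> (r p <= i < r q)%N = (r p' <= i < r q')%N.
  move=> im; move/matrixP/(_ (Ordinal im) 0): ejj'; rewrite !mxE eA eA' /=.
  by do 2!case: (_ <= _ < _)%N.
have [qm q'm] := (r_le q, r_le q').
(* Comparing the two segments at their four ends determines them; an upper end equal to [m] is no
   coordinate, but is then the largest possible one. *)
have := (seg (r p), seg (r p'), seg (r q), seg (r q')) => -[[[segp segp'] segq] segq'].
apply/inj_g/val_inj; rewrite eg eg'.
have -> : p = p' by apply: inj_r; lia.
by have -> : q = q' by apply: inj_r; lia.
Qed.

Lemma edge_sorted (G : sgraph) (r : G -> nat) (u : edge G) : injective r ->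
  exists p q : G, val u = [set p; q] /\ (r p < r q)%N.
Proof.
move=> inj_r; have /eqP/cards2P[p [q [npq eu]]] := edges_card (valP u).
case: (ltngtP (r p) (r q)) => [lt|gt|/inj_r e]; first by exists p, q.
  by exists q, p; rewrite setUC.
by rewrite e eqxx in npq.
Qed.

Lemma graph_segment_encoding (G : sgraph) : exists (m n : nat)
    (A : 'M['F_2]_(m, n)) (r : G -> nat) (g : 'I_n -> edge G),
  [/\ injective r, forall x, (r x <= m)%N, bijective g & segment_encoding A r g].
Proof.
pose r (x : G) : nat := enum_rank x.
have inj_r : injective r by apply: inj_comp val_inj enum_rank_inj.
exists #|G|, #|{: edge G}|.
(* The bound [i.+1] includes rank [i], which turns [r p < i.+1 <= r q] into [r p <= i < r q]. *)
exists (\matrix_(i, j) \sum_(x | (r x < i.+1)%N) incidence (enum_val j) x), r.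
exists enum_val; split=> //.
- by move=> x; apply/ltnW/ltn_ord.
- exact: enum_val_bij.
move=> j; have [p [q [eg rpq]]] := edge_sorted (enum_val j) inj_r.
exists p, q; split=> // i; rewrite mxE (prefix_sum_incidence _ eg rpq).
by rewrite ltnS.
Qed.

Lemma segment_column (m : nat) (v : 'cV['F_2]_m) :
  consecutive_ones v -> v != 0 -> exists p q : 'I_m.+1,
    (p < q)%N /\ forall i, v i 0 = (p <= i < q)%:R.
Proof.
case=> a [b seg] /cV0Pn[i vi0].
(* Over ['F_2], knowing where the entries are 1 determines all of them. *)
have F2 (x : 'F_2) : x = (x == 1)%:R by apply/eqP; case: x => [[|[|]]].
have vE k : v k 0 = (a <= k < b)%:R.
  by rewrite [LHS]F2; congr (_%:R); congr nat_of_bool; apply/eqP/idP => /seg.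
have /andP[ai ib] : (a <= i < b)%N by move: vi0; rewrite vE; case: (_ <= _ < _)%N.
have im := ltn_ord i.
(* The bound [b] may exceed [m] and is clipped; [a] is in range because [a <= i < m] for the nonzero
   entry [i]. *)
exists (inord a), (inord (minn b m)).
rewrite !inordK ?ltnS ?geq_minr //; last by apply: leq_trans ai (ltnW im).
split=> [|k]; first by lia.
by rewrite vE leq_min ltn_ord andbT.
Qed.

(** The graph has vertex set ['I_m.+1], and its edges are exactly the pairs of segment ends;
    distinct columns give distinct edges. *)
Lemma simple_segment_encoding (m n : nat) (A : 'M['F_2]_(m, n)) :
  simple_segment A -> exists (G : sgraph) (r : G -> nat) (g : 'I_n -> edge G),
  [/\ injective r, forall x, (r x <= m)%N, bijective g & segment_encoding A r g].
Proof.
case=> segA nz inj_A.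
have /fin_all_exists[p /fin_all_exists[q pqP]] :
    forall j, exists p q : 'I_m.+1,
      (p < q)%N /\ forall i, A i j = (p <= i < q)%:R.
  move=> j; have [p [q [pq eA]]] := segment_column (segA j) (nz j).
  by exists p, q; split=> // i; rewrite -eA mxE.
pose e j := [set p j; q j].
have inj_e : injective e.
  move=> j k ejk; apply: inj_A; apply/matrixP => i z; rewrite !mxE.
  have [[pqj ->] [pqk ->]] := (pqP j, pqP k).
  have pk : p j \in e k by rewrite -ejk set21.
  have qk : q j \in e k by rewrite -ejk set22.
  (* Besides the wanted matching of ends, the crossed one reverses the order and the other two
     collapse [p j] and [q j]. *)
  move: pk qk; rewrite !inE => /orP[]/eqP ep /orP[]/eqP eq; rewrite ep eq // in pqj *.
  - by rewrite ltnn in pqj.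
  - by have := ltn_trans pqj pqk; rewrite ltnn.
  - by rewrite ltnn in pqj.
have e_card u : u \in [set e j | j in 'I_n] -> #|u| = 2.
  case/imsetP=> j _ ->; rewrite cards2; case: eqP => // epq.
  by have [] := pqP j; rewrite epq ltnn.
pose G := SGraph e_card.
pose g j : edge G := exist _ (e j) (imset_f e (erefl : j \in 'I_n)).
exists G, (@nat_of_ord m.+1), g; split.
- exact: ord_inj.
- by move=> x; rewrite -ltnS.
- have inj_g : injective g by move=> j k /(congr1 val)/inj_e.
  (* Surjectivity follows by counting, since the edge set is the image of [e]. *)
  apply: inj_card_bij => //; rewrite card_sig -(card_imset _ inj_e).
  exact/subset_leq_card/subsetP.
by move=> j; have [pq eA] := pqP j; exists (p j), (q j).
Qed.

Theorem theorem3 (M : matroid) :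
  simple_graphic M <->
  exists (m n : nat) (A : 'M['F_2]_(m, n)),
    simple_segment A /\ matroid_iso M (vector_matroid A).
Proof.
split=> [[G isoM]|[m [n [A [segA isoM]]]]].
  have [m [n [A [r [g [inj_r r_le bij_g enc]]]]]] := graph_segment_encoding G.
  exists m, n, A; split.
    exact: segment_encoding_simple (bij_inj bij_g) enc.
  apply: matroid_iso_trans isoM (matroid_iso_sym _).
  exact: segment_encoding_iso enc.
have [G [r [g [inj_r r_le bij_g enc]]]] := simple_segment_encoding segA.
exists G; apply: matroid_iso_trans isoM _.
exact: segment_encoding_iso enc.
Qed.
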